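(* Consider the attack-free estimation error dynamics $$e(k+1)=\bar A e(k)-B_{e1}\omega_u(k)-L\,\omega_e(k+1),\qquad \bar A:=(I-LC_e)A_e,\qquad k=0,1,2,\ldots,$$ with $e(k)\in\mathbb{R}^6$, bounded disturbance sequences $\omega_u(k)\in\mathbb{R}$, $\omega_e(k)\in\mathbb{R}^5$, and matrices $A_e\in\mathbb{R}^{6\times6}$, $B_{e1}\in\mathbb{R}^{6\times1}$, $C_e\in\mathbb{R}^{5\times6}$ as in the context. For a given $\alpha\in(0,1)$, suppose there exist positive constants $\mu_1=\mu_1^*$, $\mu_2=\mu_2^*$ and matrices $P=P^*$ (symmetric, $6\times6$) and $Y=Y^*\in\mathbb{R}^{6\times5}$ that solve the semidefinite program $$\min_{P,Y,\mu_1,\mu_2}\ \mu_1+\mu_2\quad\text{s.t.}\quad \mu_1,\mu_2>0,\quad P>\mathbf{0},$$ $$\begin{bmatrix}-P&*&*&*\\ A_e^\top(P-C_e^\top Y^\top)&(\alpha-1)P&*&*\\ B_{e1}^\top P&\mathbf{0}&-\alpha\mu_1I&*\\ Y^\top&\mathbf{0}&\mathbf{0}&-\alpha\mu_1I\end{bmatrix}\le0,\qquad \begin{bmatrix}P&I\\ I&\mu_2I\end{bmatrix}\ge0 .$$ Then, for $L=P^{-1}Y$ (with $P=P^*$, $Y=Y^*$), there exist $c>0$ and $\lambda\in(0,1)$ such that the estimation error satisfies $$|e(k)|\le c\lambda^k|e(0)|+\gamma\big(\|\omega_u\|_\infty+\|\omega_e\|_\infty\big),\qquad \gamma=\sqrt{\mu_1^*\mu_2^*},$$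 for all $k\in\mathbb{N}$.
   Context: Let $h,\tau,T_s>0$ and $k_p,k_d\in\mathbb{R}$. Define $$A_{ce}=\begin{bmatrix}0&0&-h&0&1&0\\0&0&1&0&0&0\\0&0&-\frac1\tau&\frac1\tau&0&0\\ \frac{k_p}{h}&0&-k_d&-\frac1h&\frac{k_d}{h}&0\\0&0&-1&0&0&1\\0&0&0&0&0&-\frac1\tau\end{bmatrix},\quad B_{ce1}=[0\ 0\ 0\ 0\ 0\ \tfrac1\tau]^\top,$$ $A_e=e^{A_{ce}T_s}$, $B_{e1}=\int_0^{T_s}e^{A_{ce}(T_s-s)}B_{ce1}\,ds$, and $C_e=[I_5\ \ \mathbf{0}]\in\mathbb{R}^{5\times6}$ (the first five coordinates). $|\cdot|$ is the Euclidean norm, $\|v\|_\infty=\sup_{k\ge0}|v(k)|$, and $*$ denotes the blocks determined by symmetry. $>0$, $\ge0$, $\le0$ for symmetric matrices refer to definiteness/semidefiniteness. *)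

(* Defs.v *)
From mathcomp Require Import all_boot all_order all_algebra.
From mathcomp Require Import all_classical all_reals all_analysis.
Set Implicit Arguments.
Unset Strict Implicit.
Unset Printing Implicit Defensive.
Import Order.TTheory GRing.Theory Num.Theory.
Import numFieldNormedType.Exports.
Local Open Scope classical_set_scope.
Local Open Scope ring_scope.

(* The matrix norm of MathComp-Analysis is the max norm, so the Euclidean norm
   is spelled out; [`|v|] is never used on vectors below. *)
Definition enorm (R : realType) (n : nat) (v : 'cV[R]_n) : R :=
  Num.sqrt (\sum_i v i 0 ^+ 2).

(* [sup] is 0 on unbounded sets; it is only applied to sequences bounded in
   the sense of [bounded_seq]. *)
Definition sup_seq (R : realType) (u : nat -> R) : R := sup (range u).

Definition bounded_seq (R : realType) (u : nat -> R) : Prop :=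
  has_ubound (range u).

Definition posdefmx (R : realType) (n : nat) (M : 'M[R]_n) : Prop :=
  M^T = M /\ forall x : 'cV[R]_n, x != 0 -> 0 < (x^T *m M *m x) 0 0.

Definition possemidefmx (R : realType) (n : nat) (M : 'M[R]_n) : Prop :=
  M^T = M /\ forall x : 'cV[R]_n, 0 <= (x^T *m M *m x) 0 0.

Definition negsemidefmx (R : realType) (n : nat) (M : 'M[R]_n) : Prop :=
  M^T = M /\ forall x : 'cV[R]_n, (x^T *m M *m x) 0 0 <= 0.

(* e^A as the sum of its power series, for the (entrywise) topology of
   matrices. *)
Definition expmx (R : realType) (n : nat) (A : 'M[R]_n.+1) : 'M[R]_n.+1 :=
  lim (series (fun k : nat => (k`!%:R)^-1 *: A ^+ k) @ \oo).

Definition Ace (R : realType) (h tau kp kd : R) : 'M[R]_6 :=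
  \matrix_(i < 6, j < 6)
    nth 0 (nth [::]
     [:: [:: 0     ; 0; - h      ; 0       ; 1     ; 0        ];
         [:: 0     ; 0; 1        ; 0       ; 0     ; 0        ];
         [:: 0     ; 0; - tau^-1 ; tau^-1  ; 0     ; 0        ];
         [:: kp / h; 0; - kd     ; - h^-1  ; kd / h; 0        ];
         [:: 0     ; 0; - 1      ; 0       ; 0     ; 1        ];
         [:: 0     ; 0; 0        ; 0       ; 0     ; - tau^-1 ]] i) j.

Definition Bce1 (R : realType) (tau : R) : 'cV[R]_6 :=
  \col_(i < 6) [:: 0; 0; 0; 0; 0; tau^-1]`_i.

Definition Ae (R : realType) (h tau Ts kp kd : R) : 'M[R]_6 :=
  expmx (Ts *: Ace h tau kp kd).

Definition Be1 (R : realType) (h tau Ts kp kd : R) : 'cV[R]_6 :=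
  \col_(i < 6) \int[lebesgue_measure]_(s in `[0%R, Ts])
    (expmx ((Ts - s) *: Ace h tau kp kd) *m Bce1 tau) i 0.

Definition Ce (R : realType) : 'M[R]_(5, 6) :=
  row_mx (1%:M : 'M[R]_(5, 5)) (0 : 'M[R]_(5, 1)).

Definition lmi_mx (R : realType) (A : 'M[R]_6) (B : 'cV[R]_6)
    (C : 'M[R]_(5, 6)) (alpha : R) (P : 'M[R]_6) (Y : 'M[R]_(6, 5)) (mu1 : R) :
    'M[R]_(6 + (6 + (1 + 5))) :=
  let M21 : 'M[R]_(6, 6) := A^T *m (P - C^T *m Y^T) in
  let M31 : 'M[R]_(1, 6) := B^T *m P in
  let M41 : 'M[R]_(5, 6) := Y^T in
  col_mx (row_mx (- P) (row_mx M21^T               (row_mx M31^T              M41^T)))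
 (col_mx (row_mx M21   (row_mx ((alpha - 1) *: P)  (row_mx 0                  0)))
 (col_mx (row_mx M31   (row_mx 0                   (row_mx (- (alpha * mu1))%:M 0)))
         (row_mx M41   (row_mx 0                   (row_mx 0                  (- (alpha * mu1))%:M))))).

Definition sdp_feasible (R : realType) (A : 'M[R]_6) (B : 'cV[R]_6)
    (C : 'M[R]_(5, 6)) (alpha : R) (P : 'M[R]_6) (Y : 'M[R]_(6, 5))
    (mu1 mu2 : R) : Prop :=
  [/\ 0 < mu1, 0 < mu2, posdefmx P,
      negsemidefmx (lmi_mx A B C alpha P Y mu1) &
      possemidefmx (block_mx P 1%:M 1%:M mu2%:M)].

Definition sdp_solution (R : realType) (A : 'M[R]_6) (B : 'cV[R]_6)
    (C : 'M[R]_(5, 6)) (alpha : R) (P : 'M[R]_6) (Y : 'M[R]_(6, 5))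
    (mu1 mu2 : R) : Prop :=
  sdp_feasible A B C alpha P Y mu1 mu2 /\
  forall (P' : 'M[R]_6) (Y' : 'M[R]_(6, 5)) (mu1' mu2' : R),
    sdp_feasible A B C alpha P' Y' mu1' mu2' -> mu1 + mu2 <= mu1' + mu2'.

Definition error_dynamics (R : realType) (A : 'M[R]_6) (B : 'cV[R]_6)
    (C : 'M[R]_(5, 6)) (L : 'M[R]_(6, 5)) (wu : nat -> R)
    (we : nat -> 'cV[R]_5) (e : nat -> 'cV[R]_6) : Prop :=
  forall k : nat,
    e k.+1 = ((1%:M - L *m C) *m A) *m e k - wu k *: B - L *m we k.+1.

(* Main.v *)
(** Take the Lyapunov function [V e = e^T P e].  Evaluating the first LMI at
    [(e(k+1), e(k), - wu(k), - we(k+1))] makes its first block row vanish, since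
    [P L = Y], and what remains is
    [V(k+1) <= (1 - alpha) V(k) + alpha mu1 (wu(k)^2 + |we(k+1)|^2)].
    Iterating bounds [V(k)] by [(1 - alpha)^k V(0) + mu1 (|wu|^2 + |we|^2)], and the
    second LMI, which says [P >= mu2^-1 I], turns this into a bound on [|e(k)|]
    with rate [lambda = sqrt (1 - alpha)]. *)
Require Import Defs.
From mathcomp Require Import all_boot all_order all_algebra.
From mathcomp Require Import all_classical all_reals all_analysis.
From mathcomp Require Import ring lra.
Import Order.TTheory GRing.Theory Num.Theory.
Import numFieldNormedType.Exports.
Local Open Scope ring_scope.

Lemma enorm_ge0 (R : realType) (n : nat) (v : 'cV[R]_n) : 0 <= enorm v.
Proof. exact: sqrtr_ge0. Qed.

Lemma sqr_enorm (R : realType) (n : nat) (v : 'cV[R]_n) :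
  enorm v ^+ 2 = (v^T *m v) 0 0.
Proof.
rewrite sqr_sqrtr; last by apply: sumr_ge0 => i _; exact: sqr_ge0.
by rewrite mxE; apply: eq_bigr => i _; rewrite mxE expr2.
Qed.

Lemma coord_le_enorm (R : realType) (n : nat) (v : 'cV[R]_n) (i : 'I_n) :
  `|v i 0| <= enorm v.
Proof.
rewrite -sqrtr_sqr ler_wsqrtr // (bigD1 i) //= lerDl.
by apply: sumr_ge0 => j _; exact: sqr_ge0.
Qed.

(** A crude entrywise estimate suffices: it is applied only to [V 0], so its constant ends up in [c]
    and leaves the gain untouched. *)
Lemma quadform_le (R : realType) (n : nat) (M : 'M[R]_n) (x : 'cV[R]_n) :
  (x^T *m M *m x) 0 0 <= (\sum_j \sum_i `|M i j|) * enorm x ^+ 2.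
Proof.
rewrite mxE mulr_suml ler_sum // => j _.
rewrite mxE !mulr_suml ler_sum // => i _.
rewrite (le_trans (ler_norm _)) // !normrM mxE mulrAC mulrC.
by rewrite expr2 ler_wpM2l // ler_pM // coord_le_enorm.
Qed.

Lemma posdefmx_unit (R : realType) (n : nat) (M : 'M[R]_n) :
  posdefmx M -> M \in unitmx.
Proof.
move=> [_ Mpos]; rewrite unitmxE unitfE; apply/det0P => -[v vN0 vM0].
have := Mpos v^T; rewrite -[v^T == 0](inj_eq (@trmx_inj _ _ _)) trmxK trmx0.
by move=> /(_ vN0); rewrite vM0 mul0mx mxE ltxx.
Qed.

(** The dynamics enter multiplied by [P], so that the gain [invmx P *m Y] shows up only as [Y] and
    every term matches a block of the LMI. Here [x] is the successor of [y]. *)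
Lemma lmi_dissipation (R : realType) (A : 'M[R]_6) (B : 'cV[R]_6)
    (C : 'M[R]_(5, 6)) (alpha : R) (P : 'M[R]_6) (Y : 'M[R]_(6, 5)) (mu1 : R)
    (x y : 'cV[R]_6) (u : R) (w : 'cV[R]_5) :
  P^T = P -> negsemidefmx (lmi_mx A B C alpha P Y mu1) ->
  P *m x = (P - Y *m C) *m A *m y - u *: (P *m B) - Y *m w ->
  (x^T *m P *m x) 0 0 <=
    (1 - alpha) * (y^T *m P *m y) 0 0 + alpha * (mu1 * (u ^+ 2 + enorm w ^+ 2)).
Proof.
move=> Psym [_ /(_ (col_mx x (col_mx y (col_mx (- u)%:M (- w)))))] lmi Px.
pose M21 := A^T *m (P - C^T *m Y^T).
have M21T : M21^T = (P - Y *m C) *m A.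
  by rewrite /M21 trmx_mul trmxK linearB /= trmx_mul !trmxK Psym.
have M31T : (B^T *m P)^T = P *m B by rewrite trmx_mul trmxK Psym.
have {}Px : P *m x = M21^T *m y + ((B^T *m P)^T *m (- u)%:M + Y *m - w).
  by rewrite Px M21T M31T mul_mx_scalar scaleNr mulmxN addrA.
(* With the first block row gone, the first block column still pairs [y], [- u], [- w] with [x]; by
   this identity it contributes exactly [x^T *m P *m x]. *)
have PxT : x^T *m P = y^T *m M21 + ((- u)%:M *m (B^T *m P) - w^T *m Y^T).
  rewrite -[x^T *m P]trmxK trmx_mul trmxK Psym Px !linearD /= !trmx_mul !trmxK.
  by rewrite tr_scalar_mx linearN /= mulNmx.
move: lmi; rewrite /lmi_mx -/M21 -mulmxA !mul_col_mx !mul_row_col trmxK.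
rewrite !mul0mx !addr0 !add0r mulNmx -Px addNr.
rewrite !tr_col_mx !mul_row_col mulmx0 add0r.
have entD (M N : 'M[R]_1) : (M + N) 0 0 = M 0 0 + N 0 0 by rewrite mxE.
have entZ a (M : 'M[R]_1) : (a *: M) 0 0 = a * M 0 0 by rewrite mxE.
have entN (M : 'M[R]_1) : (- M) 0 0 = - M 0 0 by rewrite mxE.
rewrite PxT !(mulmxDl, mulmxDr) tr_scalar_mx linearN /= !(mulNmx, mulmxN).
rewrite !mul_scalar_mx -!scalemxAl -!scalemxAr !mulmxA -?scalemxAl.
rewrite !(entD, entN, entZ) -sqr_enorm [_%:M 0 0]mxE mulr1n.
lra.
Qed.

Lemma enorm_sqr_le_quadform (R : realType) (n : nat) (P : 'M[R]_n) (mu : R)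
    (x : 'cV[R]_n) :
  0 < mu -> possemidefmx (block_mx P 1%:M 1%:M mu%:M) ->
  enorm x ^+ 2 <= mu * (x^T *m P *m x) 0 0.
Proof.
(* A Schur complement by test vector: on [(mu x, - x)] the second block row gives [mu x - mu x = 0],
   leaving [mu * (mu * x^T P x - x^T x) >= 0]. *)
move=> mu_gt0 [_ /(_ (col_mx (mu *: x) (- x)))].
rewrite tr_col_mx -mulmxA mul_block_col mul_row_col !mul1mx mul_scalar_mx.
rewrite scalerN subrr mulmx0 addr0 linearZ /= -scalemxAl mulmxBr -!scalemxAr.
rewrite mulmxA => Pmu; rewrite sqr_enorm -subr_ge0 -(pmulr_rge0 _ mu_gt0).
move: Pmu; set M := _ *m P *m _; set N := _ *m x.
by rewrite !mxE.
Qed.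

(** [d] is the fixed point of [v |-> rho v + (1 - rho) d], so the offset reproduces itself at each
    step and no geometric sum is needed. *)
Lemma iter_contraction_le (R : realType) (rho d : R) (V : nat -> R) :
  0 <= rho -> (forall k, V k.+1 <= rho * V k + (1 - rho) * d) -> 0 <= d ->
  forall k, V k <= rho ^+ k * V 0%N + d.
Proof.
move=> rho_ge0 Vstep d_ge0; elim=> [|k IH]; first by rewrite expr0 mul1r lerDl.
rewrite (le_trans (Vstep k)) // exprS.
have := ler_wpM2l rho_ge0 IH; lra.
Qed.

Lemma sup_seq_ge (R : realType) (u : nat -> R) (k : nat) :
  bounded_seq u -> u k <= sup_seq u.
Proof. by move=> ub; apply: ub_le_sup => //; exists k. Qed.

Lemma le_add_of_sqr_le (R : realType) (x a b : R) :
  0 <= a -> 0 <= b -> x ^+ 2 <= a ^+ 2 + b ^+ 2 -> x <= a + b.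
Proof. by move=> a0 b0; nra. Qed.

Theorem lemma3 (R : realType) (h tau Ts kp kd : R)
    (h_gt0 : 0 < h) (tau_gt0 : 0 < tau) (Ts_gt0 : 0 < Ts)
    (alpha : R) (alpha_gt0 : 0 < alpha) (alpha_lt1 : alpha < 1)
    (P : 'M[R]_6) (Y : 'M[R]_(6, 5)) (mu1 mu2 : R)
    (sol : sdp_solution (Ae h tau Ts kp kd) (Be1 h tau Ts kp kd) (Ce R)
             alpha P Y mu1 mu2) :
  exists c lambda : R, [/\ 0 < c, 0 < lambda, lambda < 1 &
    forall (wu : nat -> R) (we : nat -> 'cV[R]_5) (e : nat -> 'cV[R]_6),
      bounded_seq (fun k => `|wu k|) ->
      bounded_seq (fun k => enorm (we k)) ->
      error_dynamics (Ae h tau Ts kp kd) (Be1 h tau Ts kp kd) (Ce R)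
        (invmx P *m Y) wu we e ->
      forall k : nat,
        enorm (e k) <= c * lambda ^+ k * enorm (e 0%N)
          + Num.sqrt (mu1 * mu2) *
            (sup_seq (fun j => `|wu j|) + sup_seq (fun j => enorm (we j)))].
Proof.
have [[mu1_gt0 mu2_gt0 Ppos lmi1 lmi2] _] := sol.
move: {sol} (Ae _ _ _ _ _) (Be1 _ _ _ _ _) (Ce R) lmi1 => A B C lmi1.
have [Psym _] := Ppos; have Punit := posdefmx_unit _ _ _ Ppos.
pose p := \sum_j \sum_i `|P i j|.
have p_ge0 : 0 <= p by do 2!apply: sumr_ge0 => ? _.
(* Chosen so that [mu2 * V 0 <= c ^+ 2 * enorm (e 0) ^+ 2]. The witness is [c + 1], which is
   positive as soon as [0 <= c]. *)
pose c := Num.sqrt (mu2 * p).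
have c_ge0 : 0 <= c by exact: sqrtr_ge0.
have rho_gt0 : 0 < 1 - alpha by rewrite subr_gt0.
exists (c + 1), (Num.sqrt (1 - alpha)); split.
- by rewrite ltr_wpDl.
- by rewrite sqrtr_gt0.
- by rewrite -[ltRHS]sqrtr1 ltr_sqrt // gtrBl.
move=> wu we e wu_bnd we_bnd dyn k.
set a := sup_seq (fun j => `|wu j|); set b := sup_seq (fun j => enorm (we j)).
have wu_le j : `|wu j| <= a by exact: (sup_seq_ge _ _ j wu_bnd).
have we_le j : enorm (we j) <= b by exact: (sup_seq_ge _ _ j we_bnd).
have a_ge0 : 0 <= a := le_trans (normr_ge0 _) (wu_le 0%N).
have b_ge0 : 0 <= b := le_trans (enorm_ge0 _ _ _) (we_le 0%N).
pose V j := ((e j)^T *m P *m e j) 0 0.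
(* The factor [alpha] is written [1 - (1 - alpha)] to fit [iter_contraction_le] with
   [rho = 1 - alpha]. *)
have Vstep j : V j.+1 <= (1 - alpha) * V j
    + (1 - (1 - alpha)) * (mu1 * (a ^+ 2 + b ^+ 2)).
  have Pe : P *m e j.+1 = (P - Y *m C) *m A *m e j - wu j *: (P *m B)
      - Y *m we j.+1.
    rewrite dyn !mulmxBr -scalemxAr !mulmxA mulmxBr mulmx1 !mulmxA.
    by rewrite mulmxV // mul1mx.
  apply: (le_trans (lmi_dissipation _ _ _ _ _ _ _ _ _ _ _ _ Psym lmi1 Pe)).
  rewrite lerD2l opprB addrCA subrr addr0 !ler_pM2l //.
  rewrite -[wu j ^+ 2]real_normK ?num_real //.
  by rewrite lerD // lerXn2r // nnegrE enorm_ge0.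
have Vk := iter_contraction_le _ _ _ _ (ltW rho_gt0) Vstep
  (mulr_ge0 (ltW mu1_gt0) (addr_ge0 (sqr_ge0 a) (sqr_ge0 b))) k.
have V0 : V 0%N <= p * enorm (e 0%N) ^+ 2 by exact: quadform_le.
have ek := enorm_sqr_le_quadform _ _ _ _ (e k) mu2_gt0 lmi2.
have mu_ge0 : 0 <= mu1 * mu2 by rewrite mulr_ge0 // ltW.
have lamk_ge0 : 0 <= Num.sqrt (1 - alpha) ^+ k by rewrite exprn_ge0 ?sqrtr_ge0.
have e0_ge0 := enorm_ge0 _ _ (e 0%N).
apply: (@le_trans _ _ (c * Num.sqrt (1 - alpha) ^+ k * enorm (e 0%N)
    + Num.sqrt (mu1 * mu2) * (a + b))); last first.
  by rewrite lerD2r ler_wpM2r // ler_wpM2r // lerDl.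
apply: le_add_of_sqr_le; rewrite ?mulr_ge0 ?sqrtr_ge0 ?addr_ge0 //.
rewrite !exprMn /c -exprM mulnC exprM (sqr_sqrtr (ltW rho_gt0)).
rewrite (sqr_sqrtr mu_ge0).
rewrite (sqr_sqrtr (mulr_ge0 (ltW mu2_gt0) p_ge0)).
apply: (le_trans ek).
have {}Vk := le_trans Vk
  (lerD (ler_wpM2l (exprn_ge0 k (ltW rho_gt0)) V0) (lexx _)).
apply: (le_trans (ler_wpM2l (ltW mu2_gt0) Vk)).
(* The nonnegative cross term gives [a ^+ 2 + b ^+ 2 <= (a + b) ^+ 2], whence the gain
   [Num.sqrt (mu1 * mu2)] on the sum of the two suprema. *)
have ab : 0 <= mu1 * mu2 * (a * b) by rewrite !mulr_ge0 ?(ltW mu1_gt0) ?(ltW mu2_gt0).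
rewrite sqrrD -mulr_natr.
nra.
Qed.
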